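(* Let $X$ be a $1$-dimensional Lévy basket with an associated family of risk-neutral measures $(\mathbb{P}^x)_{x\in\mathbb{R}}$ and discount rate $r>0$. Let $G=(-\infty,\gamma)$ for some $\gamma\in\mathbb{R}$. Then for all $s>0$ (whenever $\rho(s)(\gamma)$ is well-defined, in which case the limits as $t\downarrow0$ below exist) \begin{align*} \rho(s)(\gamma)&=\left.\sum_{n=1}^\infty e^{-rnt}\,\mathbb{P}^\gamma\left[\bigcap_{i=1}^{n-1}\{X_{it}\ge\gamma\}\cap\{X_{nt}<\gamma\}\right]\right|^{t\downarrow0}_{t=s}\\ &=\left[\exp\left(-\sum_{n=1}^\infty\frac{e^{-rnt}}{n}\,\mathbb{P}^0\{X_{nt}<0\}\right)\right]^{t=s}_{t\downarrow0}. \end{align*}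
   Context: Lévy basket (dimension one): $X=(X_t)_{t\ge 0}$ is a real-valued càdlàg process adapted to a filtration $(\mathcal{F}_t)_{t\ge0}$, together with probability measures $(\mathbb{P}^x)_{x\in\mathbb{R}}$ (the risk-neutral measures; expectation $\mathbb{E}^x$) and a constant $r>0$ (the discount rate), such that for every $x$, under $\mathbb{P}^x$, $X$ starts at $x$ and is a homogeneous Markov process with respect to $(\mathcal{F}_t)$ whose transition function (not depending on $x$) is a translation-invariant Feller semigroup (so $X$ is a Lévy process started at $x$), and such that for some constant $\delta_1\ge0$ (dividend yield) the process $\exp(X_t-(r-\delta_1)t)$ is a $\mathbb{P}^x$-martingale. For $t>0$, $\tau_G^{t\mathbb{N}}:=\min\{u\in t\mathbb{N}: X_u\in G\}$, $\mathbb{N}=\{1,2,\dots\}$ ($\tau=+\infty$ if there is no such $u$, with $e^{-r\cdot\infty}=0$), and $$\rho(s)(x):=\lim_{t\downarrow0}\mathbb{E}^x\left[e^{-r\tau_G^{t\mathbb{N}}}-e^{-r\tau_G^{s\mathbb{N}}}\right]$$ whenever this limit exists (''$\rho(s)(x)$ is well-defined''). Notation: $\left.F(t)\right|^{t\downarrow0}_{t=s}:=\lim_{t\downarrow0}F(t)-F(s)$ and $[F(t)]^{t=s}_{t\downarrow0}:=F(s)-\lim_{t\downarrow0}F(t)$. *)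

(* Defs.v *)
From HB Require Import structures.
From mathcomp Require Import all_boot all_order all_algebra.
From mathcomp Require Import all_classical all_reals all_analysis.
From mathcomp Require Import measurable_realfun.
Set Implicit Arguments.
Unset Strict Implicit.
Unset Printing Implicit Defensive.
Import Order.TTheory GRing.Theory Num.Theory.
Import numFieldTopology.Exports numFieldNormedType.Exports.
Local Open Scope classical_set_scope.
Local Open Scope ring_scope.

(* Processes are indexed by all of R; only their values at times t >= 0 are
   constrained or used. *)

Definition is_filtration (R : realType) d (Omega : measurableType d)
    (F : R -> set (set Omega)) : Prop :=
  [/\ forall t : R, 0 <= t -> sigma_algebra setT (F t),
      forall t : R, 0 <= t -> F t `<=` measurable
    & forall s t : R, 0 <= s -> s <= t -> F s `<=` F t].

Definition adapted (R : realType) d (Omega : measurableType d)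
    (F : R -> set (set Omega)) (X : R -> Omega -> R) : Prop :=
  forall t : R, 0 <= t -> forall B : set R, measurable B -> F t (X t @^-1` B).

Definition cadlag (R : realType) (f : R -> R) : Prop :=
  (forall t : R, 0 <= t -> f u @[u --> t^'+] --> f t) /\
  (forall t : R, 0 < t -> cvg (f u @[u --> t^'-])).

(* Z is a version of the conditional expectation E[Y | H]. *)
Definition is_cond_exp (R : realType) d (Omega : measurableType d)
    (P : probability Omega R) (H : set (set Omega)) (Y Z : Omega -> \bar R) :
    Prop :=
  [/\ forall B : set (\bar R), measurable B -> H (Z @^-1` B),
      P.-integrable setT Z
    & forall A, H A -> (\int[P]_(w in A) Z w = \int[P]_(w in A) Y w)%E].

Definition is_martingale (R : realType) d (Omega : measurableType d)
    (P : probability Omega R) (F : R -> set (set Omega)) (M : R -> Omega -> R) :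
    Prop :=
  [/\ adapted F M,
      forall t : R, 0 <= t -> P.-integrable setT (EFin \o M t)
    & forall s t : R, 0 <= s -> s <= t ->
        is_cond_exp P (F s) (EFin \o M t) (EFin \o M s)].

(* The space C_0(R) of continuous functions vanishing at infinity. *)
Definition C0 (R : realType) : set (R -> R) :=
  [set f | [/\ continuous f, f x @[x --> -oo] --> 0 & f x @[x --> +oo] --> 0]].

Definition kernel_op (R : realType) (k : R.-pker R ~> R) (f : R -> R) : R -> R :=
  fun x => \int[k x]_(y in setT) f y.

Definition is_transition_function (R : realType) (p : R -> R.-pker R ~> R) :
    Prop :=
  (forall x (B : set R), measurable B -> p 0 x B = \d_x B) /\
  (forall s t : R, 0 <= s -> 0 <= t -> forall x (B : set R), measurable B ->
     p (s + t) x B = (\int[p s x]_y p t y B)%E).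

Definition is_feller (R : realType) (p : R -> R.-pker R ~> R) : Prop :=
  [/\ is_transition_function p,
      forall t : R, 0 <= t -> forall f, C0 f -> C0 (kernel_op (p t) f)
    & forall f, C0 f -> {uniform, kernel_op (p t) f @[t --> 0^'+] --> f}].

Definition translation_invariant (R : realType) (p : R -> R.-pker R ~> R) :
    Prop :=
  forall t : R, 0 <= t -> forall x h (B : set R), measurable B ->
    p t (x + h) B = p t x [set y | B (y + h)].

Definition is_markov (R : realType) d (Omega : measurableType d)
    (P : probability Omega R) (F : R -> set (set Omega)) (X : R -> Omega -> R)
    (p : R -> R.-pker R ~> R) : Prop :=
  forall s t : R, 0 <= s -> 0 <= t -> forall B : set R, measurable B ->
    is_cond_exp P (F s) (EFin \o \1_(X (s + t) @^-1` B))
                        (fun w => p t (X s w) B).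

Record levy_basket (R : realType) d (Omega : measurableType d)
    (F : R -> set (set Omega)) (X : R -> Omega -> R)
    (P : R -> probability Omega R) (r : R) : Prop := LevyBasket {
  lb_filtration : is_filtration F ;
  lb_adapted : adapted F X ;
  lb_cadlag : forall w, cadlag (fun t => X t w) ;
  lb_rate : 0 < r ;
  lb_start : forall x, P x [set w | X 0 w = x] = 1%E ;
  lb_markov : exists p : R -> R.-pker R ~> R,
    [/\ is_feller p, translation_invariant p
      & forall x, is_markov (P x) F X p] ;
  lb_martingale : exists2 delta : R, 0 <= delta &
    forall x, is_martingale (P x) F
      (fun t w => expR (X t w - (r - delta) * t)) }.

(* For t > 0 the infimum is a minimum unless the set is empty, in which case
   it is +oo. *)
Definition tau (R : realType) (Omega : Type) (X : R -> Omega -> R) (G : set R)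
    (t : R) (w : Omega) : \bar R :=
  ereal_inf [set (n%:R * t)%:E |
              n in [set n : nat | (0 < n)%N /\ G (X (n%:R * t) w)]].

(* e^{-r u}, which is 0 at u = +oo when r > 0. *)
Definition discount (R : realType) (r : R) (u : \bar R) : R :=
  fine (expeR (- (r%:E * u))%E).

Definition rho_approx (R : realType) d (Omega : measurableType d)
    (X : R -> Omega -> R) (P : R -> probability Omega R) (r : R) (G : set R)
    (s x t : R) : \bar R :=
  ('E_(P x)[fun w => (discount r (tau X G t w) - discount r (tau X G s w))%R])%E.

(* For s, t > 0 the expectation lies in [-1, 1], so convergence in \bar R is
   convergence in R. *)
Definition rho_well_defined (R : realType) d (Omega : measurableType d)
    (X : R -> Omega -> R) (P : R -> probability Omega R) (r : R) (G : set R)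
    (s x : R) : Prop :=
  cvg (rho_approx X P r G s x t @[t --> 0^'+]).

Definition rho (R : realType) d (Omega : measurableType d)
    (X : R -> Omega -> R) (P : R -> probability Omega R) (r : R) (G : set R)
    (s x : R) : \bar R :=
  lim (rho_approx X P r G s x t @[t --> 0^'+]).

Definition first_passage_series (R : realType) d (Omega : measurableType d)
    (X : R -> Omega -> R) (P : R -> probability Omega R) (r gamma t : R) :
    \bar R :=
  (\sum_(1 <= n <oo) (expR (- (r * n%:R * t))%R)%:E *
     P gamma ((\bigcap_(i in [set i : nat | (1 <= i < n)%N])
                 [set w | (gamma <= X (i%:R * t) w)%R]) `&`
              [set w | (X (n%:R * t) w < gamma)%R]))%E.

Definition spitzer_exp (R : realType) d (Omega : measurableType d)
    (X : R -> Omega -> R) (P : R -> probability Omega R) (r t : R) : \bar R :=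
  (expeR (- (\sum_(1 <= n <oo) (expR (- (r * n%:R * t)) / n%:R)%R%:E *
               P 0%R [set w | (X (n%:R * t) w < 0)%R])))%E.

(* Main.v *)
Require Import Defs.
From HB Require Import structures.
From mathcomp Require Import all_boot all_order all_algebra.
From mathcomp Require Import all_classical all_reals all_analysis.
From mathcomp Require Import measurable_realfun.
From mathcomp Require Import ring lra zify.
Import Order.TTheory GRing.Theory Num.Theory.
Import numFieldTopology.Exports numFieldNormedType.Exports.
Local Open Scope classical_set_scope.
Local Open Scope ring_scope.

(** Sampling a Levy process started at gamma at the times t, 2t, 3t, ... gives,
    after subtraction of gamma, a random walk S with i.i.d. steps whose law mu
    is the transition probability from 0 in time t.  With z = e^(-rt), the
    expected discount at the first passage below gamma is the generating
    function A(z) of the first time n >= 1 at which S_n < 0, because the events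
    of a first passage at step n are disjoint.  This is the first formula.  The
    second one is the Sparre Andersen - Spitzer identity
      1 - A(z) = exp (- sum_n z^n / n * P (S_n < 0)).
    Hence the expected discount, the series and one minus the exponential are
    one and the same function of t > 0, and the convergence of its increments
    as t decreases to 0 transfers from one form to the others.

    The identity follows from the recursion
      n q_n = sum_(1 <= k <= n) P (S_k >= 0) q_(n - k),
    where q_n is the probability that S_1, ..., S_n are all nonnegative.  To
    obtain it, let Q_n be the law of S_n on the event that S_1, ..., S_n >= 0
    and let B_k be the law of S_k on the event that S_k >= 0.  One proves
    n Q_n = sum_k B_k * Q_(n - k), with convolution products, by induction on n
    ([spitzer_sumE]).  A further step of the walk turns the factor Q_(n - k)
    into Q_(n - k + 1), as in the sum of index n + 1, plus the law of a first
    exit.  The convolution of B_k with that law, cut off to the nonnegative half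
    line, consists of the paths that return after a first exit, once the k
    steps of B_k are put after the exit ([free_walk_exiting_walk], which is
    Fubini's theorem).  By the decomposition of a free path at its first exit
    ([free_walk_first_exit]), these returning paths make up the difference
    between B_(n + 1), the last term of the sum of index n + 1, and Q_(n + 1).
    Finite measures are represented by the functionals that they induce on
    nonnegative measurable functions.

    The recursion says that the generating function Q of the q_n satisfies
    Q' = L' Q, where L has the coefficients P (S_n >= 0) / n; thus Q exp (- L) is constant
    on [0, 1[ ([pseries_log_derivative]).  The same statement for constant
    coefficients 1 gives 1 / (1 - z) = exp (sum_n z^n / n), and dividing one
    equality by the other yields the identity, since A(z) = 1 - (1 - z) Q(z). *)

(** * Expectations along a random walk with i.i.d. steps *)

Section random_walk.
Local Set Implicit Arguments.
Local Unset Strict Implicit.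
Local Unset Printing Implicit Defensive.
Local Open Scope ereal_scope.
Context {R : realType} (mu : probability R R).
Implicit Types (D : set R) (f g : R -> \bar R).

Definition nnmeas d (T : measurableType d) (f : T -> \bar R) :=
  measurable_fun setT f /\ forall x, 0 <= f x.

(** Transition operator of the walk killed outside D. *)
Definition step D f x : \bar R := \int[mu]_y (f \_ D) (x + y)%R.

Lemma nnmeas_restrict D f : measurable D -> nnmeas f -> nnmeas (f \_ D).
Proof.
move=> mD [mf f0]; split; last by move=> x; rewrite patchE; case: ifP.
by apply/(measurable_restrictT _ _).1 => //; exact: measurable_funTS.
Qed.

Lemma nnmeas_comp d1 d2 (T1 : measurableType d1) (T2 : measurableType d2)
    (f : T2 -> \bar R) (g : T1 -> T2) :
  measurable_fun setT g -> nnmeas f -> nnmeas (fun x => f (g x)).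
Proof. by move=> mg [mf f0]; split => //; exact: (measurableT_comp mf). Qed.

Lemma nnmeas_cst d (T : measurableType d) (c : \bar R) : 0 <= c ->
  nnmeas (cst c : T -> _).
Proof. by move=> c0; split => //; exact: measurable_cst. Qed.

(** Measurability jointly with a parameter t is what makes Fubini's theorem
    available between two steps of the walk, the first step playing the role
    of the parameter for the following ones. *)
Lemma nnmeas_step_param d (T : measurableType d) D (F : T * R -> \bar R) :
  measurable D -> nnmeas F ->
  nnmeas (fun z : T * R => step D (fun x => F (z.1, x)) z.2).
Proof.
move=> mD [mF F0].
have [mG G0] : nnmeas (fun z : (T * R) * R =>
    (F \_ (setT `*` D)) (z.1.1, (z.1.2 + z.2)%R)).
  apply: (@nnmeas_comp _ _ _ _ (F \_ (setT `*` D))).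
    apply: measurable_fun_pair => /=.
      exact: measurableT_comp measurable_fst measurable_fst.
    apply: measurable_funD => //.
    exact: measurableT_comp measurable_snd measurable_fst.
  split; last by move=> x; rewrite patchE; case: ifP.
  apply/(measurable_restrictT _ _).1; first exact: measurableX.
  exact: measurable_funTS.
split; last first.
  by move=> z; apply: integral_ge0 => y _; rewrite patchE; case: ifP.
have := measurable_fun_fubini_tonelli_F (m2 := mu) _ mG G0.
rewrite /fubini_F /=; congr measurable_fun; apply/funext => -[t x] /=.
apply: eq_integral => y _; rewrite !patchE /=; congr (if _ then _ else _).
by apply/idP/idP; rewrite !inE/= => // -[].
Qed.

Lemma nnmeas_iter_param d (T : measurableType d) D n (F : T * R -> \bar R) :
  measurable D -> nnmeas F ->
  nnmeas (fun z : T * R => iter n (step D) (fun x => F (z.1, x)) z.2).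
Proof.
move=> mD hF; elim: n => [|n IH] /=.
  by rewrite (_ : (fun _ => _) = F)//; apply/funext => -[].
exact: (nnmeas_step_param mD IH).
Qed.

Lemma nnmeas_section d (T : measurableType d) (F : T * R -> \bar R) (t : T) :
  nnmeas F -> nnmeas (fun x => F (t, x)).
Proof. by apply: nnmeas_comp; exact: measurable_pair1. Qed.

Lemma nnmeas_slice d (T : measurableType d) (F : T * R -> \bar R) (x : R) :
  nnmeas F -> nnmeas (fun t => F (t, x)).
Proof. by apply: nnmeas_comp; exact: measurable_pair2. Qed.

Lemma nnmeas_iter D n f : measurable D -> nnmeas f ->
  nnmeas (iter n (step D) f).
Proof.
move=> mD hf.
have hF : nnmeas (fun z : R * R => f z.2) := nnmeas_comp measurable_snd hf.
have := @nnmeas_section _ R _ (0 : R)%R (nnmeas_iter_param n mD hF).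
exact.
Qed.

Lemma nnmeas_step D f : measurable D -> nnmeas f -> nnmeas (step D f).
Proof. by move=> mD hf; exact: (@nnmeas_iter D 1 f mD hf). Qed.

Lemma nnmeas_shift f (x : R) : nnmeas f -> nnmeas (fun y : R => f (x + y)%R).
Proof. by apply: nnmeas_comp; apply: measurable_funD. Qed.

Lemma step_restrict D f : step D (f \_ D) = step D f.
Proof.
apply/funext => x; apply: eq_integral => y _.
by rewrite !patchE; case: (_ \in D).
Qed.

Lemma step_shift f x y :
  step setT f (x + y)%R = step setT (fun z => f (x + z)%R) y.
Proof. by apply: eq_integral => z _; rewrite !patch_setT addrA. Qed.

Lemma stepD D f g : measurable D -> nnmeas f -> nnmeas g ->
  step D (f \+ g) = step D f \+ step D g.
Proof.
move=> mD hf hg; apply/funext => x.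
have [mf f0] := nnmeas_shift x (nnmeas_restrict mD hf).
have [mg g0] := nnmeas_shift x (nnmeas_restrict mD hg).
rewrite /step /= -ge0_integralD//.
by apply: eq_integral => y _; rewrite !patchE; case: (_ \in D); rewrite ?adde0.
Qed.

Lemma stepZ D f (c : \bar R) : measurable D -> nnmeas f -> 0 <= c ->
  step D (fun x => c * f x) = fun x => c * step D f x.
Proof.
move=> mD hf c0; apply/funext => x.
have [mf f0] := nnmeas_shift x (nnmeas_restrict mD hf).
rewrite /step /= -ge0_integralZl//.
by apply: eq_integral => y _; rewrite !patchE; case: (_ \in D); rewrite ?mule0.
Qed.

Lemma step_setC D f : measurable D -> nnmeas f ->
  step setT f = step D f \+ step (~` D) f.
Proof.
move=> mD hf; apply/funext => x.
have [mg g0] := nnmeas_shift x (nnmeas_restrict mD hf).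
have [mh h0] := nnmeas_shift x (nnmeas_restrict (measurableC mD) hf).
rewrite /step /= -ge0_integralD//.
apply: eq_integral => y _; rewrite !patchE in_setT in_setC.
by case: (_ \in D); rewrite ?adde0 ?add0e.
Qed.

Lemma step_le1 D f : measurable D -> nnmeas f -> (forall x, f x <= 1) ->
  forall x, step D f x <= 1.
Proof.
move=> mD hf f1 x.
have [mg g0] := nnmeas_shift x (nnmeas_restrict mD hf).
apply: (@le_trans _ _ (\int[mu]_y 1)); last first.
  by rewrite integral_cst// mul1e probability_le1.
by apply: ge0_le_integral => // y _; rewrite patchE; case: ifP.
Qed.

Lemma step_cst1 : step setT (cst 1) = cst 1.
Proof.
apply/funext => x; rewrite /step; under eq_integral do rewrite patch_setT /=.
by rewrite integral_cst// mul1e; exact: probability_setT.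
Qed.

Lemma iter_stepD D n f g : measurable D -> nnmeas f -> nnmeas g ->
  iter n (step D) (f \+ g) = iter n (step D) f \+ iter n (step D) g.
Proof.
move=> mD hf hg; elim: n => //= n ->.
by rewrite stepD//; exact: nnmeas_iter.
Qed.

Lemma iter_stepZ D n f (c : \bar R) : measurable D -> nnmeas f -> 0 <= c ->
  iter n (step D) (fun x => c * f x) = fun x => c * iter n (step D) f x.
Proof.
move=> mD hf c0; elim: n => //= n ->.
by rewrite stepZ//; exact: nnmeas_iter.
Qed.

Lemma iter_step_le1 D n f : measurable D -> nnmeas f ->
  (forall x, f x <= 1) -> forall x, iter n (step D) f x <= 1.
Proof.
move=> mD hf f1; elim: n => //= n IH.
by apply: step_le1 => //; exact: nnmeas_iter.
Qed.

Lemma iter_step0 D n x : iter n (step D) (cst 0) x = 0.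
Proof.
elim: n x => //= n IH x.
rewrite /step; under eq_integral do rewrite patchE IH if_same.
exact: integral0.
Qed.

(** An average over a parameter commutes with a step of the walk; this is the
    only source of commutativity for convolution products below. *)
Lemma step_fubini d (T : measurableType d) (nu : probability T R) D
    (F : T * R -> \bar R) x : measurable D -> nnmeas F ->
  \int[nu]_t step D (fun y => F (t, y)) x =
  step D (fun y => \int[nu]_t F (t, y)) x.
Proof.
move=> mD [mF F0].
have mG : measurable_fun setT (F \_ (setT `*` D)).
  apply/(measurable_restrictT _ _).1; first exact: measurableX.
  exact: measurable_funTS.
rewrite /step (fubini_tonelli (fun z : T * R =>
    ((fun y => F (z.1, y)) \_ D) (x + z.2)%R)) /=.
- apply: eq_integral => y _; rewrite patchE; case: ifP => h.
    by apply: eq_integral => t _; rewrite patchE h.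
  by under eq_integral do rewrite patchE h; rewrite integral0.
- rewrite (_ : (fun _ => _) = (F \_ (setT `*` D)) \o
      (fun z : T * R => (z.1, (x + z.2)%R))).
    apply: measurableT_comp => //; apply: measurable_fun_pair => //=.
    exact: measurable_funD.
  apply/funext => -[t y] /=; rewrite !patchE /=; congr (if _ then _ else _).
  by apply/idP/idP; rewrite !inE/= => // -[].
- by move=> z; rewrite patchE; case: ifP.
Qed.

Lemma iter_step_fubini d (T : measurableType d) (nu : probability T R) D n
    (F : T * R -> \bar R) x : measurable D -> nnmeas F ->
  \int[nu]_t iter n (step D) (fun y => F (t, y)) x =
  iter n (step D) (fun y => \int[nu]_t F (t, y)) x.
Proof.
move=> mD hF; elim: n x => //= n IH x.
rewrite (@step_fubini _ _ _ _ (fun z : T * R =>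
  iter n (step D) (fun y => F (z.1, y)) z.2)) //; last exact: nnmeas_iter_param.
by congr (step D _ x); apply/funext => y; exact: IH.
Qed.

(** * Paths that stay in a half line *)

(** Closure of D under addition keeps a convolution of two laws carried by D
    inside D; closure of its complement keeps outside D the sum of a position
    outside D and of a first exit position. *)
Section semigroup_splitting.
Variable D : set R.
Hypothesis mD : measurable D.
Hypothesis D0 : D 0%R.
Hypothesis DD : forall x y, D x -> D y -> D (x + y)%R.
Hypothesis ND : forall x y, ~ D x -> ~ D y -> ~ D (x + y)%R.

Let mN : measurable (~` D). Proof. exact: measurableC. Qed.

Definition free_walk n f := iter n (step setT) f.
Definition surviving_walk n f := iter n (step D) f 0%R.

(** The first exit from D happens at step n + 1, at the position where f is
    evaluated. *)
Definition exiting_walk n f := surviving_walk n (step (~` D) f).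

Arguments free_walk : simpl never.
Arguments surviving_walk : simpl never.

Lemma free_walkS n f : free_walk n.+1 f = step setT (free_walk n f).
Proof. by []. Qed.

Lemma nnmeas_free_walk n f : nnmeas f -> nnmeas (free_walk n f).
Proof. exact: nnmeas_iter. Qed.

Lemma free_walkD n f g x : nnmeas f -> nnmeas g ->
  free_walk n (f \+ g) x = free_walk n f x + free_walk n g x.
Proof. by move=> hf hg; rewrite /free_walk iter_stepD. Qed.

Lemma free_walkZ n f (c : \bar R) x : nnmeas f -> 0 <= c ->
  free_walk n (fun x => c * f x) x = c * free_walk n f x.
Proof. by move=> hf c0; rewrite /free_walk iter_stepZ. Qed.

Lemma surviving_walk_ge0 n f : nnmeas f -> 0 <= surviving_walk n f.
Proof. by move=> hf; apply: (nnmeas_iter n mD hf).2. Qed.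

Lemma surviving_walk_step n f : nnmeas f ->
  surviving_walk n (step setT f) = surviving_walk n.+1 f + exiting_walk n f.
Proof.
move=> hf; rewrite /surviving_walk (step_setC mD hf).
rewrite iter_stepD//; try exact: nnmeas_step.
by rewrite -iterSr.
Qed.

(** Decomposition of a path of n steps at its first exit from D: peeling off the
    last steps one at a time, each of them either stays in D or exits. *)
Lemma free_walk_first_exit n f : nnmeas f ->
  free_walk n f 0%R = surviving_walk n f +
    \sum_(j < n) exiting_walk j (free_walk (n - j.+1) f).
Proof.
elim: n f => [|n IH] f hf; first by rewrite big_ord0 adde0.
rewrite [free_walk _ _]iterSr -/(free_walk n _) IH; last exact: nnmeas_step.
rewrite surviving_walk_step// big_ord_recr /= subnn -addeA; congr (_ + _).
rewrite addeC; congr (_ + _); apply: eq_bigr => -[j /= jn] _.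
by rewrite /free_walk -iterSr subnSK// subSS.
Qed.

Lemma surviving_walk_restrict n f :
  surviving_walk n (f \_ D) = surviving_walk n f.
Proof.
case: n => [|n]; first by rewrite /surviving_walk/= patchE mem_set.
by rewrite /surviving_walk 2!iterSr step_restrict.
Qed.

Lemma exiting_walk_restrict n f :
  exiting_walk n (f \_ (~` D)) = exiting_walk n f.
Proof. by rewrite /exiting_walk step_restrict. Qed.

Lemma nnmeas_surviving_walk_shift n f : nnmeas f ->
  nnmeas (fun x : R => surviving_walk n (fun y : R => f (x + y)%R)).
Proof.
move=> hf; have hF : nnmeas (fun z : R * R => f (z.1 + z.2)%R).
  by apply: nnmeas_comp => //; exact: measurable_funD.
exact: (nnmeas_slice 0%R (nnmeas_iter_param n mD hF)).
Qed.

Lemma nnmeas_exiting_walk_shift n f : nnmeas f ->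
  nnmeas (fun x : R => exiting_walk n (fun y : R => f (x + y)%R)).
Proof.
move=> hf; have hF : nnmeas (fun z : R * R => f (z.1 + z.2)%R).
  by apply: nnmeas_comp => //; exact: measurable_funD.
exact: (nnmeas_slice 0%R (nnmeas_iter_param n mD (nnmeas_step_param mN hF))).
Qed.

(** Commutativity of the convolution of the law of k free steps with the law of
    a first exit position. *)
Lemma free_walk_exiting_walk k n f x : nnmeas f ->
  free_walk k (fun u => exiting_walk n (fun y : R => f (u + y)%R)) x =
  exiting_walk n (fun y : R => free_walk k f (x + y)%R).
Proof.
move=> hf; elim: k x => // k IH x.
pose F (z : R * R) := free_walk k f (x + z.1 + z.2)%R.
have hF : nnmeas F.
  apply: (nnmeas_comp _ (nnmeas_free_walk k hf)).
  by apply: measurable_funD => //; exact: measurable_funD.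
transitivity (\int[mu]_t exiting_walk n (fun y => F (t, y))).
  by rewrite free_walkS; apply: eq_integral => t _; rewrite patch_setT IH.
rewrite /exiting_walk /surviving_walk.
rewrite (@iter_step_fubini _ _ mu D n (fun z : R * R =>
  step (~` D) (fun y => F (z.1, y)) z.2))//; last exact: nnmeas_step_param.
have EF : (fun y => \int[mu]_t F (t, y)) = fun y => free_walk k.+1 f (x + y)%R.
  apply/funext => y; rewrite free_walkS; apply: eq_integral => t _.
  by rewrite patch_setT /F /= -!addrA (addrC t).
congr (iter n _ _ _); apply/funext => u /=.
by apply: etrans (step_fubini mu u mN hF) _; rewrite EF.
Qed.

(** With B_k the law of the k-th position restricted to D, and Q_m the law of
    the m-th position on the event that the first m positions lie in D, this is
    the integral of f against the sum of B_(k + 1) * Q_(n - k - 1). *)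
Definition spitzer_sum n f : \bar R := \sum_(k < n)
  free_walk k.+1
    ((fun x => surviving_walk (n - k.+1) (fun y => f (x + y)%R)) \_ D) 0%R.

Lemma exiting_walk_vanish n f :
  (forall y, ~ D y -> f y = 0) -> exiting_walk n f = 0.
Proof.
move=> f0; rewrite -exiting_walk_restrict (_ : _ \_ _ = cst 0).
  rewrite /exiting_walk /surviving_walk (_ : step _ _ = cst 0) ?iter_step0//.
  by apply/funext => y; exact: (iter_step0 _ 1).
by apply/funext => y; rewrite patchE; case: ifPn => //; rewrite inE => /f0.
Qed.

(** The extra step that extends a factor Q_n of the convolution sum.  The exit
    term carries no restriction to D in the starting point x, because a start
    outside D followed by an exit from D ends outside D, where f is cut off. *)
Lemma surviving_walk_step_shift n f : nnmeas f ->
  (fun x : R => surviving_walk n (fun y : R => step D f (x + y)%R)) \_ D =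
  ((fun x => surviving_walk n.+1 (fun y => f (x + y)%R)) \_ D) \+
  (fun x : R => exiting_walk n (fun y : R => (f \_ D) (x + y)%R)).
Proof.
move=> hf; have hfD := nnmeas_restrict mD hf.
apply/funext => x /=; rewrite !patchE.
have [Dx|nDx] := pselect (D x); last first.
  rewrite memNset// exiting_walk_vanish ?adde0// => y nDy.
  by rewrite patchE memNset//; exact: ND.
rewrite mem_set// -(surviving_walk_restrict _ (fun y => f (x + y)%R)).
rewrite (_ : _ \_ D = (fun y => (f \_ D) (x + y)%R) \_ D); last first.
  apply/funext => y; rewrite !patchE.
  have [Dy|nDy] := pselect (D y); last by rewrite memNset.
  by rewrite mem_set// mem_set//; exact: DD.
rewrite surviving_walk_restrict -surviving_walk_step; last exact: nnmeas_shift.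
congr (iter n _ _ _); apply/funext => y.
by rewrite -step_shift; apply: eq_integral => z _; rewrite patch_setT.
Qed.

(** The sum of rank n + 1 contains the extended sum of rank n, up to the exit
    terms Rest, and the isolated term B_(n + 1); the first exit decomposition
    identifies B_(n + 1) with Q_(n + 1) plus the same exit terms. *)
Lemma spitzer_sumS n f : nnmeas f ->
  spitzer_sum n.+1 f = surviving_walk n.+1 f + spitzer_sum n (step D f).
Proof.
move=> hf; have hfD := nnmeas_restrict mD hf.
pose A := \sum_(k < n)
  free_walk k.+1
    ((fun x => surviving_walk (n - k) (fun y => f (x + y)%R)) \_ D) 0%R.
pose Rest := \sum_(k < n) exiting_walk (n - k.+1) (free_walk k.+1 (f \_ D)).
have EC : spitzer_sum n.+1 f = A + free_walk n.+1 (f \_ D) 0%R.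
  rewrite /spitzer_sum big_ord_recr /=; congr (_ + _).
  congr (free_walk _ _ _); rewrite subnn; apply/funext => x.
  by rewrite !patchE /surviving_walk /= addr0.
have EB : free_walk n.+1 (f \_ D) 0%R = surviving_walk n.+1 f + Rest.
  rewrite free_walk_first_exit// surviving_walk_restrict; congr (_ + _).
  rewrite big_ord_recr /= subnn exiting_walk_vanish ?adde0; last first.
    by move=> y nDy; rewrite /free_walk /= patchE memNset.
  rewrite /Rest (reindex_inj rev_ord_inj) /=; apply: eq_bigr => -[k /= kn] _.
  by rewrite (_ : n.+1 - (n - k.+1).+1 = k.+1)%N//; lia.
have EU : spitzer_sum n (step D f) = A + Rest.
  rewrite -big_split /=; apply: eq_bigr => -[k /= kn] _.
  rewrite surviving_walk_step_shift// subnSK// free_walkD; last 2 first.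
    by apply: nnmeas_restrict => //; exact: nnmeas_surviving_walk_shift.
    exact: nnmeas_exiting_walk_shift.
  rewrite (free_walk_exiting_walk k.+1 (n - k.+1) 0%R hfD).
  by under [X in exiting_walk _ X]eq_fun do rewrite add0r.
by rewrite EC EB EU addeCA.
Qed.

(** Measure version of the recursion n q_n = sum_k b_k q_(n - k). *)
Lemma spitzer_sumE n f : nnmeas f ->
  spitzer_sum n f = n%:R%:E * surviving_walk n f.
Proof.
elim: n f => [|n IH] f hf; first by rewrite /spitzer_sum big_ord0 mul0e.
rewrite spitzer_sumS// IH; last exact: nnmeas_step.
rewrite /surviving_walk -iterSr -[X in X + _]mul1e -ge0_muleDl ?lee_fin//.
by rewrite -EFinD -natr1 addrC.
Qed.

End semigroup_splitting.
End random_walk.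

(** * Power series with a prescribed logarithmic derivative *)

Section power_series.
Context {R : realType}.
Implicit Types (c q b : R^nat) (x z : R).

Lemma ler_natr_geometric n (y : R) : 0 <= y < 1 ->
  n.+1%:R * y ^+ n <= (1 - y)^-1.
Proof.
move=> /andP[y0 y1]; have y10 : 0 < 1 - y by rewrite subr_gt0.
have le_sum : n.+1%:R * y ^+ n <= \sum_(i < n.+1) y ^+ i.
  rewrite mulr_natl -[X in _ *+ X](card_ord n.+1) -sumr_const.
  by apply: ler_sum => -[i /= ilt] _; apply: ler_wiXn2l => //; exact: ltW.
apply: (le_trans le_sum); rewrite -[leRHS]mul1r ler_pdivlMr// mulrC.
by rewrite -opprB mulNr -subrX1 opprB gerBl exprn_ge0.
Qed.

(** Quadratic growth covers a series with coefficients bounded by 1, its first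
    two formal derivatives, and the product of two such series. *)
Lemma is_cvg_pseries_quadratic c x :
  (forall n, `|c n| <= (n.+1 * n.+2)%:R) -> `|x| < 1 -> cvgn (pseries c x).
Proof.
(* y is such that |x| <= y^3 < 1, by Bernoulli's inequality: two factors y^n
   absorb the growth of the coefficients and the third one is summable. *)
move=> cn x1; pose y := 1 - (1 - `|x|) / 4.
have x0 := normr_ge0 x.
have y01 : 0 <= y < 1 by rewrite /y; apply/andP; split; lra.
have xy : `|x| <= y ^+ 3.
  rewrite /y; set e := (1 - `|x|) / 4.
  have e0 : 0 <= e by rewrite /e; lra.
  have e1 : e <= 1 by rewrite /e; lra.
  have -> : `|x| = 1 - 4 * e by rewrite /e; lra.
  by have := mulr_ge0 e0 (mulr_ge0 e0 e0); rewrite 3!exprS expr0; nra.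
case/andP: (y01) => y0 y1.
apply: normed_cvg.
apply: (@series_le_cvg _ _ (geometric (2 * (1 - y)^-1 * (1 - y)^-1) y)) => //.
- by move=> n /=; exact: normr_ge0.
- move=> n.
  by rewrite /geometric/= !mulr_ge0 ?exprn_ge0// invr_ge0 subr_ge0 ltW.
- move=> n; rewrite /geometric /= normrM normrX.
  apply: (@le_trans _ _ ((n.+1 * n.+2)%:R * y ^+ 3 ^+ n)).
    by apply: ler_pM => //; rewrite lerXn2r// nnegrE exprn_ge0.
  have yn0 : 0 <= y ^+ n by rewrite exprn_ge0.
  have h := ler_natr_geometric n y y01.
  have h2 : n.+2%:R * y ^+ n <= 2 * (1 - y)^-1.
    apply: (@le_trans _ _ (2 * (n.+1%:R * y ^+ n))); last by rewrite ler_pM2l.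
    by rewrite mulrA ler_wpM2r// -natrM ler_nat; lia.
  have -> : (n.+1 * n.+2)%:R * y ^+ 3 ^+ n =
      (n.+2%:R * y ^+ n) * (n.+1%:R * y ^+ n) * y ^+ n.
    by rewrite natrM -exprM mulnC !exprM 3!exprS expr0; ring.
  by rewrite ler_wpM2r// ler_pM// mulr_ge0.
- by apply: is_cvg_geometric_series; rewrite ger0_norm.
Qed.

Lemma is_derive_pseries c x : (forall n, `|c n| <= 1) -> `|x| < 1 ->
  is_derive x 1 (fun x => limn (pseries c x))
    (limn (pseries (pseries_diffs c) x)).
Proof.
move=> c1 x1; pose K := (1 + `|x|) / 2.
have xK : `|x| < K by rewrite /K; lra.
have K1 : `|K| < 1 by rewrite ger0_norm /K; have := normr_ge0 x; lra.
apply: (@pseries_snd_diffs _ _ K) => //.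
- apply: is_cvg_pseries_quadratic => // n; apply: (le_trans (c1 n)).
  by rewrite ler1n muln_gt0.
- apply: is_cvg_pseries_quadratic => // n.
  rewrite /pseries_diffs normrM normr_nat natrM ler_wpM2l//.
  by apply: (le_trans (c1 _)); rewrite ler1n.
- apply: is_cvg_pseries_quadratic => // n.
  rewrite /pseries_diffs !normrM !normr_nat mulrA -natrM ler_piMr//.
- by rewrite (ger0_norm (x := K))// /K; have := normr_ge0 x; lra.
Qed.

(** Sums of nonnegative terms over n and k <= n may be exchanged, which turns
    the Cauchy product into a product of series. *)
Lemma nneseries_convolution (a b : R^nat) :
  (forall n, 0 <= a n) -> (forall n, 0 <= b n) ->
  (\sum_(n <oo) (\sum_(k < n.+1) a k * b (n - k)%N)%:E =
  \sum_(k <oo) (a k)%:E * \sum_(n <oo) (b n)%:E)%E.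
Proof.
move=> a0 b0.
pose u n k : \bar R := if (k <= n)%N then (a k * b (n - k)%N)%:E else 0%E.
have u0 n k : (0 <= u n k)%E.
  by rewrite /u; case: ifP => // _; rewrite lee_fin mulr_ge0.
transitivity (\sum_(n <oo) \sum_(k <oo) u n k)%E.
  apply: eq_eseriesr => n _; rewrite (@nneseries_split _ _ 0 n.+1)// add0n.
  rewrite [X in (_ + X)%E]eseries0 ?adde0; last first.
    by move=> k nk _; rewrite /u leqNgt nk.
  rewrite big_mkord -sumEFin; apply: eq_bigr => -[k /= kn] _.
  by rewrite /u -ltnS kn.
rewrite nneseries_interchange//; apply: eq_eseriesr => k _.
rewrite (@nneseries_split _ _ 0 k)// add0n big_nat big1 ?add0e; last first.
  by move=> n /andP[_ nk]; rewrite /u leqNgt nk.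
rewrite -nneseries_addn// -nneseriesZl; last by move=> n _; rewrite lee_fin.
by apply: eq_eseriesr => n _; rewrite /u leq_addl addnK EFinM.
Qed.

Lemma EFin_pseries c x : cvgn (pseries c x) ->
  (limn (pseries c x))%:E = (\sum_(n <oo) (c n * x ^+ n)%:E)%E.
Proof.
move=> cc; rewrite -EFin_lim//; congr (limn _); apply/funext => n /=.
by rewrite /series /= sumEFin.
Qed.

Lemma pseries_mul c d x :
  (forall n, 0 <= c n <= 1) -> (forall n, 0 <= d n <= 1) -> 0 <= x < 1 ->
  limn (pseries (fun n => \sum_(k < n.+1) c k * d (n - k)%N) x) =
  limn (pseries c x) * limn (pseries d x).
Proof.
move=> c01 d01 /andP[x0 x1].
have nx1 : `|x| < 1 by rewrite ger0_norm.
have c0 n : 0 <= c n by case/andP: (c01 n).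
have d0 n : 0 <= d n by case/andP: (d01 n).
have cvg1 (e : R^nat) : (forall n, 0 <= e n <= 1) -> cvgn (pseries e x).
  move=> e01; apply: is_cvg_pseries_quadratic => // n.
  case/andP: (e01 n) => ? ?; rewrite ger0_norm//.
  by apply: (@le_trans _ _ 1) => //; rewrite ler1n.
have cvg2 : cvgn (pseries (fun n => \sum_(k < n.+1) c k * d (n - k)%N) x).
  apply: is_cvg_pseries_quadratic => // n.
  rewrite ger0_norm; last by apply: sumr_ge0 => k _; rewrite mulr_ge0.
  apply: (@le_trans _ _ (\sum_(k < n.+1) 1)).
    by apply: ler_sum => k _; case/andP: (c01 k) => _ ?;
      case/andP: (d01 (n - k)%N) => _ ?; exact: mulr_ile1.
  by rewrite sumr_const card_ord ler_nat leq_pmulr.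
apply: EFin_inj; rewrite EFinM !EFin_pseries//; try exact: cvg1.
transitivity (\sum_(n <oo) (\sum_(k < n.+1) (c k * x ^+ k) *
    (d (n - k)%N * x ^+ (n - k)))%:E)%E.
  apply: eq_eseriesr => n _; congr EFin; rewrite mulr_suml.
  by apply: eq_bigr => -[k /= kn] _; rewrite mulrACA -exprD subnKC.
rewrite (@nneseries_convolution
  (fun k => c k * x ^+ k) (fun k => d k * x ^+ k));
  [|by move=> n; rewrite mulr_ge0// exprn_ge0..].
rewrite -(EFin_pseries d)//; last exact: cvg1.
rewrite muleC -nneseriesZl; last first.
  by move=> n _; rewrite lee_fin mulr_ge0// exprn_ge0.
by apply: eq_eseriesr => n _; rewrite muleC.
Qed.

Lemma pseries_at0 c : limn (pseries c 0) = c 0%N.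
Proof.
apply/cvg_lim => //; rewrite -(cvg_shiftn 1) /=.
rewrite (_ : (fun _ => _) = cst (c 0%N)); first exact: cvg_cst.
apply/funext => n; rewrite /pseries /series /= addn1 big_nat_recl//=.
rewrite expr0 mulr1.
by rewrite big1 ?addr0// => i _; rewrite expr0n mulr0.
Qed.

(** The recursion reads Q' = L' Q, so that Q exp (- L) is constant.  The
    coefficient of index 0 in L is b 0 / 0 = 0, whence L(0) = 0. *)
Lemma pseries_log_derivative q b z :
  q 0%N = 1 -> (forall n, 0 <= q n <= 1) -> (forall n, 0 <= b n <= 1) ->
  (forall n, n.+1%:R * q n.+1 = \sum_(k < n.+1) b k.+1 * q (n - k)%N) ->
  0 <= z < 1 ->
  limn (pseries q z) = expR (limn (pseries (fun n => b n / n%:R) z)).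
Proof.
move=> q0 q01 b01 qb /andP[z0 z1].
set l := fun n => b n / n%:R.
pose Q x := limn (pseries q x); pose L x := limn (pseries l x).
have l1 n : `|l n| <= 1.
  case: n => [|n]; first by rewrite /l invr0 mulr0 normr0.
  rewrite /l normrM normfV normr_nat ger0_norm; last by case/andP: (b01 n.+1).
  by rewrite ler_pdivrMr// mul1r (le_trans (proj2 (andP (b01 _))))// ler1n.
have q1 n : `|q n| <= 1 by case/andP: (q01 n) => ? ?; rewrite ger0_norm.
pose h x := Q x * expR (- L x).
have dL x : limn (pseries (pseries_diffs l) x) =
    limn (pseries (fun n => b n.+1) x).
  congr (limn (pseries _ x)); apply/funext => n.
  by rewrite /pseries_diffs /l mulrC divfK.
have dh x : 0 <= x <= z -> is_derive x 1 h 0.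
  move=> /andP[x0 xz].
  have x1 : `|x| < 1 by rewrite ger0_norm// (le_lt_trans xz).
  have dQ := is_derive_pseries _ _ q1 x1.
  have dL' := is_derive_pseries _ _ l1 x1.
  have dE := @is_derive1_comp _ expR (- (L : R -> R)) x _ _
    (is_derive_expR (- L x)) (is_deriveN dL').
  have := is_deriveM dQ dE.
  rewrite -[_ * _]/h.
  congr is_derive; rewrite /GRing.scale /=.
  rewrite dL.
  have -> : limn (pseries (pseries_diffs q) x) =
      limn (pseries (fun n => b n.+1) x) * limn (pseries q x).
    rewrite -pseries_mul ?x0 ?(le_lt_trans xz)//; congr (limn (pseries _ x)).
    by apply/funext => n; rewrite /pseries_diffs qb.
  by ring.
have : h z - h 0 = 0.
  have [| |c _ ->] := @MVT_segment R h (fun=> 0) 0 z z0; last by rewrite mul0r.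
  - move=> x; rewrite in_itv/= => /andP[/ltW ? /ltW ?].
    by apply: dh; apply/andP.
  - apply: derivable_within_continuous => x; rewrite in_itv/= => xz.
    by have [] := dh x xz.
rewrite /h /Q /L !pseries_at0 q0 /l invr0 mulr0 oppr0 expR0 mulr1.
move/eqP; rewrite subr_eq0 => /eqP H.
rewrite [LHS](_ : _ = Q z * expR (- L z) * expR (L z)).
  by rewrite /Q /L H mul1r.
by rewrite -mulrA -expRD addNr expR0 mulr1.
Qed.

End power_series.

(** * The Sparre Andersen - Spitzer identity *)

Section sparre_andersen.
Context {R : realType} (mu : probability R R).

Let D : set R := `[0, +oo[%classic.
Let mD : measurable D. Proof. exact: measurable_itv. Qed.
Let D0 : D 0. Proof. by rewrite /D /= in_itv/= lexx. Qed.
Let DD x y : D x -> D y -> D (x + y).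
Proof. by rewrite /D /= !in_itv/= !andbT; exact: addr_ge0. Qed.
Let ND x y : ~ D x -> ~ D y -> ~ D (x + y).
Proof.
rewrite /D /= !in_itv/= !andbT => /negP; rewrite -ltNge => x0 /negP.
rewrite -ltNge => y0; apply/negP; rewrite -ltNge.
by rewrite -[ltRHS]addr0 ltrD.
Qed.

Let one : R -> \bar R := cst 1%E.
Let hone : nnmeas one. Proof. exact: nnmeas_cst. Qed.
Let honeD : nnmeas (one \_ D). Proof. exact: nnmeas_restrict. Qed.
Let honeN : nnmeas (one \_ (~` D)).
Proof. by apply: nnmeas_restrict => //; exact: measurableC. Qed.

Let q n := fine (surviving_walk mu D n one).
Let b n := fine (free_walk mu n (one \_ D) 0).

Lemma surviving_walk_le1 n : (surviving_walk mu D n one <= 1)%E.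
Proof. exact: iter_step_le1. Qed.

Lemma free_walk_le1 n : (free_walk mu n (one \_ D) 0%R <= 1)%E.
Proof.
by apply: iter_step_le1 => // x; rewrite patchE; case: ifP.
Qed.

Let survivingE n : surviving_walk mu D n one = (q n)%:E.
Proof.
rewrite fineK// ge0_fin_numE; last exact: surviving_walk_ge0.
by rewrite (le_lt_trans (surviving_walk_le1 n))// ltry.
Qed.

Let freeE n : free_walk mu n (one \_ D) 0%R = (b n)%:E.
Proof.
rewrite fineK// ge0_fin_numE; last exact: (nnmeas_free_walk mu n honeD).2.
by rewrite (le_lt_trans (free_walk_le1 n))// ltry.
Qed.

Let q01 n : 0 <= q n <= 1.
Proof.
rewrite -lee_fin -[(_ <= 1)%R]lee_fin -survivingE.
by rewrite surviving_walk_le1 surviving_walk_ge0.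
Qed.

Let b01 n : 0 <= b n <= 1.
Proof.
rewrite -lee_fin -[(_ <= 1)%R]lee_fin -freeE free_walk_le1 andbT.
exact: (nnmeas_free_walk mu n honeD).2.
Qed.

Let exitingE n : exiting_walk mu D n one = (q n - q n.+1)%:E.
Proof.
have := @surviving_walk_step _ mu D mD n one hone.
rewrite step_cst1 -/one !survivingE => /esym.
by move=> h; rewrite EFinB -h addeAC subee// add0e.
Qed.

Let freeNE n : free_walk mu n (one \_ (~` D)) 0%R = (1 - b n)%:E.
Proof.
have : (free_walk mu n (one \_ D \+ one \_ (~` D)) 0%R = 1)%E.
  rewrite (_ : (_ \+ _)%E = one); last first.
    apply/funext => x /=; rewrite !patchE in_setC.
    by case: (_ \in D); rewrite ?adde0 ?add0e.
  rewrite /free_walk (_ : iter _ _ _ = one)//.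
  by elim: n => //= n ->; exact: step_cst1.
by rewrite free_walkD// freeE => h; rewrite EFinB -h addeAC subee// add0e.
Qed.

Let qb n : n.+1%:R * q n.+1 = \sum_(k < n.+1) b k.+1 * q (n - k)%N.
Proof.
apply: EFin_inj; rewrite EFinM -survivingE.
rewrite -(@spitzer_sumE _ mu D mD D0 DD ND)//.
rewrite -sumEFin; apply: eq_bigr => k _.
rewrite (_ : _ \_ D = fun x => ((q (n - k))%:E * (one \_ D) x)%E).
  rewrite free_walkZ// ?lee_fin; last by case/andP: (q01 (n - k)).
  by rewrite freeE -EFinM mulrC.
apply/funext => x; rewrite !patchE subSS survivingE.
by case: ifP => _; rewrite ?mule1 ?mule0.
Qed.

(** With Q the generating function of the survival probabilities q_n, the exit
    probabilities q_n - q_(n + 1) sum up to 1 - (1 - z) Q(z), and both Q(z) and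
    1 / (1 - z) are exponentials by [pseries_log_derivative]. *)
Theorem sparre_andersen_spitzer (z : R) : 0 <= z < 1 -> exists A S : R,
  [/\ (\sum_(1 <= n <oo) (z ^+ n)%:E * exiting_walk mu D n.-1 one)%E = A%:E,
      (\sum_(1 <= n <oo) (z ^+ n / n%:R)%:E *
        free_walk mu n (one \_ (~` D)) 0%R)%E = S%:E
    & 1 - A = expR (- S)].
Proof.
move=> z01; have /andP[z0 z1] := z01.
have nz1 : `|z| < 1 by rewrite ger0_norm.
have cvg1 (e : R^nat) : (forall n, `|e n| <= 1) -> cvgn (pseries e z).
  move=> e01; apply: is_cvg_pseries_quadratic => // n.
  by rewrite (le_trans (e01 n))// ler1n.
pose Q := limn (pseries q z).
pose L (c : R^nat) := limn (pseries (fun n => c n / n%:R) z).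
have cl (c : R^nat) : (forall n, 0 <= c n <= 1) ->
    pseries (fun n => c n / n%:R) z @ \oo --> L c.
  move=> c01; apply: cvg1 => -[|n]; first by rewrite invr0 mulr0 normr0.
  case/andP: (c01 n.+1) => c0 c1; rewrite normrM normfV normr_nat ger0_norm//.
  by rewrite ler_pdivrMr// mul1r (le_trans c1)// ler1n.
have cQ : pseries q z @ \oo --> Q.
  by apply: cvg1 => n; case/andP: (q01 n) => ? ?; rewrite ger0_norm.
have QE : Q = expR (L b) by apply: pseries_log_derivative => //; rewrite /q.
have LE : (1 - z)^-1 = expR (L (cst 1)).
  rewrite -(@pseries_log_derivative _ (cst 1))//; last 3 first.
  - by move=> n; rewrite ler01 lexx.
  - by move=> n; rewrite ler01 lexx.
  - move=> n; rewrite mulr1 (eq_bigr (fun=> 1)); last first.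
      by move=> i _; rewrite mulr1.
    by rewrite sumr_const card_ord.
  by have := @cvg_geometric_series _ 1 z nz1; rewrite div1r => /cvg_lim <-.
exists (1 - (1 - z) * Q), (L (cst 1) - L b); split.
- apply/cvg_lim => //; rewrite -(cvg_shiftS _ _) /=.
  rewrite (_ : (fun _ => _) = EFin \o (fun n =>
      z * pseries q z n - (pseries q z n.+1 - 1))).
    apply: cvg_EFin; first by near=> n.
    rewrite (_ : 1 - (1 - z) * Q = z * Q - (Q - 1)); last by ring.
    apply: cvgB; first exact: cvgMr.
    by apply: cvgB; [rewrite cvg_shiftS|exact: cvg_cst].
  apply/funext => n /=; elim: n => [|n IH].
    rewrite big_geq// /pseries /series /= big_geq// big_nat1 expr0 mulr1.
    by rewrite /q /surviving_walk /= mulr0 subrr subr0.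
  rewrite big_nat_recr//= IH exitingE -EFinM -EFinD /pseries /series /=.
  rewrite (big_nat_recr n.+1)//= (big_nat_recr n)//=; congr EFin.
  rewrite !exprS; ring.
- apply/cvg_lim => //; rewrite -(cvg_shiftS _ _) /=.
  rewrite (_ : (fun _ => _) = EFin \o (fun n =>
      pseries (fun n => cst 1 n / n%:R) z n.+1 -
      pseries (fun n => b n / n%:R) z n.+1)).
    apply: cvg_EFin; first by near=> n.
    by apply: cvgB; rewrite cvg_shiftS; apply: cl => // n; rewrite ler01 lexx.
  apply/funext => n /=; elim: n => [|n IH].
    rewrite big_geq// /pseries /series /= !big_nat1 invr0.
    by rewrite !mulr0 !mul0r subrr.
  rewrite big_nat_recr// IH freeNE /= -EFinM -EFinD /pseries /series /=.
  rewrite (big_nat_recr n.+1)//= (big_nat_recr n.+1)//=; congr EFin.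
  ring.
- by rewrite [in RHS]opprB expRD QE expRN -LE invrK; ring.
Unshelve. all: by end_near. Qed.

End sparre_andersen.

(** * From a Markov process to a random walk *)

Section conditional_law.
Local Open Scope ereal_scope.
Context {R : realType} d (Omega : measurableType d).
Context (P : {measure set Omega -> \bar R}) (A : set Omega) (Y : Omega -> R).
Context (k : Omega -> {measure set R -> \bar R}).
Hypothesis mA : measurable A.
Hypothesis mY : measurable_fun setT Y.
Hypothesis mk : forall U, measurable U -> measurable_fun setT (fun w => k w U).
Hypothesis kE : forall U, measurable U ->
  \int[P]_(w in A) (\1_(Y @^-1` U) w)%:E = \int[P]_(w in A) k w U.

Import HBNNSimple.

Lemma integral_conditional_law_nnsfun (g : {nnsfun R >-> R}) :
  \int[P]_(w in A) (g (Y w))%:E = \int[P]_(w in A) \int[k w]_y (g y)%:E.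
Proof.
have mgY r : measurable (Y @^-1` (g @^-1` [set r])).
  by rewrite -[X in measurable X]setTI; apply: mY.
transitivity (\int[P]_(w in A) \sum_(r \in range g)
    (r%:E * (\1_(Y @^-1` (g @^-1` [set r])) w)%:E)).
  by apply: eq_integral => w _; rewrite fimfunE -fsumEFin.
under [RHS]eq_integral do rewrite integralT_nnsfun sintegralE.
rewrite !ge0_integral_fsum//; last 4 first.
- by move=> r; apply: measurable_funeM; apply: measurable_funTS; exact: mk.
- by move=> r w _; exact: nnsfun_mulemu_ge0.
- move=> r; apply: measurable_funeM; apply/measurable_EFinP.
  exact: measurable_funTS.
- move=> r w _; rewrite -EFinM lee_fin.
  exact: (nnfun_muleindic_ge0 g r (Y w)).
apply: eq_fsbigr => r; rewrite inE /= => -[x _ <-].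
rewrite !ge0_integralZl//= ?lee_fin// ?kE//.
- by apply: measurable_funTS; exact: mk.
- by apply/measurable_EFinP; exact: measurable_funTS.
Qed.

(** The Markov property is an identity between probabilities of events; passing
    from events to nonnegative functions uses simple functions and monotone
    convergence. *)
Lemma integral_conditional_law f : nnmeas f ->
  \int[P]_(w in A) f (Y w) = \int[P]_(w in A) \int[k w]_y f y.
Proof.
move=> [mf f0]; pose g := nnsfun_approx measurableT mf.
have nd_g x m n : (m <= n)%N -> (g m x)%:E <= (g n x)%:E.
  by move=> mn; rewrite lee_fin; exact/lefP/nd_nnsfun_approx.
have cvg_g x : (g n x)%:E @[n --> \oo] --> f x by exact: cvg_nnsfun_approx.
transitivity (limn (fun n => \int[P]_(w in A) (g n (Y w))%:E)).
  rewrite -monotone_convergence//.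
  - by apply: eq_integral => w _; apply/esym/cvg_lim.
  - move=> n; apply/measurable_EFinP; apply: measurable_funTS.
    exact: measurableT_comp.
  - by move=> n w _; rewrite lee_fin.
  - by move=> w _ m n; exact: nd_g.
transitivity (limn (fun n => \int[P]_(w in A) \int[k w]_y (g n y)%:E)).
  apply: congr_lim; apply/funext => n.
  exact: integral_conditional_law_nnsfun.
rewrite -monotone_convergence//.
- apply: eq_integral => w _; apply/cvg_lim => //.
  rewrite (_ : \int[k w]_y f y =
      \int[k w]_y limn (fun n => (g n y)%:E)); last first.
    by apply: eq_integral => y _; apply/esym/cvg_lim.
  apply: cvg_monotone_convergence => //.
  + by move=> n; exact/measurable_EFinP.
  + by move=> n y _; rewrite lee_fin.
  + by move=> y _ m n; exact: nd_g.
- move=> n; apply: measurable_funTS; apply: measurable_fun_integral_kernel.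
  + exact: mk.
  + by move=> y; rewrite lee_fin.
  + exact/measurable_EFinP.
- by move=> n w _; apply: integral_ge0 => y _; rewrite lee_fin.
- move=> w _ m n mn; apply: ge0_le_integral => //.
  + by move=> y _; rewrite lee_fin.
  + exact/measurable_EFinP.
  + exact/measurable_EFinP.
  + by move=> y _; exact: nd_g.
Qed.

End conditional_law.

Section markov_random_walk.
Local Set Implicit Arguments.
Local Unset Strict Implicit.
Context {R : realType} d (Omega : measurableType d).
Context (F : R -> set (set Omega)) (X : R -> Omega -> R).
Context (P : probability Omega R) (p : R -> R.-pker R ~> R) (x0 t : R).
Context (mu : probability R R).
Hypothesis filtF : is_filtration F.
Hypothesis adX : adapted F X.
Hypothesis start : P [set w | X 0 w = x0] = 1%E.
Hypothesis pinv : translation_invariant p.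
Hypothesis markovX : is_markov P F X p.
Hypothesis t0 : 0 <= t.
Hypothesis muE : forall B, measurable B -> mu B = p t 0 B.

Let T (n : nat) : R := n%:R * t.
Let Y n w : R := X (T n) w - x0.

Let T0 n : 0 <= T n. Proof. by rewrite /T mulr_ge0. Qed.
Let TS n : T n.+1 = T n + t. Proof. by rewrite /T -natr1 mulrDl mul1r. Qed.

Let FM s A : 0 <= s -> F s A -> measurable A.
Proof. by case: filtF => _ FM _ s0; exact: FM. Qed.

Let mX s : 0 <= s -> measurable_fun setT (X s).
Proof.
by move=> s0 _ B mB; rewrite setTI; apply: (FM s0); exact: adX.
Qed.

(** Translation invariance: the transition law from x is the law of x plus one
    step of the walk. *)
Lemma integral_transition x g : nnmeas g ->
  (\int[p t x]_y g (y - x0)%R = step mu setT g (x - x0)%R)%E.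
Proof.
move=> hg; have hgx : nnmeas (fun y : R => g (y - x0)).
  by apply: nnmeas_comp hg; exact: measurable_funB.
have mshift : measurable_fun setT (fun y : R => y + x).
  exact: measurable_funD.
rewrite (@eq_measure_integral _ _ _ _
    (pushforward mu (fun y : R => y + x))); last first.
  move=> B mB _; rewrite -[in LHS](add0r x) pinv// -muE//.
  by rewrite -[X in measurable X]setTI; exact: mshift.
rewrite ge0_integral_pushforward//; last 2 first.
- exact: hgx.1.
- by move=> y _; exact: hgx.2.
rewrite preimage_setT; apply: eq_integral => y _ /=.
by rewrite patch_setT; congr (g _); ring.
Qed.

Lemma markov_step n A g : F (T n) A -> nnmeas g ->
  (\int[P]_(w in A) g (Y n.+1 w) = \int[P]_(w in A) step mu setT g (Y n w))%E.
Proof.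
move=> FA hg; have mA := FM (T0 n) FA.
under [RHS]eq_integral do rewrite -integral_transition//.
have hgx : nnmeas (fun y : R => g (y - x0)).
  by apply: nnmeas_comp hg; exact: measurable_funB.
rewrite /Y TS.
apply: (@integral_conditional_law _ _ _ P A (X (T n + t))
  (fun w => p t (X (T n) w))) hgx => //.
- by apply: mX; rewrite addr_ge0.
- move=> U mU; apply: (measurableT_comp (measurable_kernel (p t) U mU)).
  exact: mX.
- by move=> U mU; case: (markovX (T0 n) t0 mU) => _ _ /(_ A FA) ->.
Qed.

Variable D : set R.
Hypothesis mD : measurable D.

Definition stays n :=
  [set w | forall i, (1 <= i <= n)%N -> D (X (i%:R * t) w - x0)].

Lemma stays0 : stays 0 = setT.
Proof. by apply/seteqP; split=> // w _ [|i] //=; rewrite andbF. Qed.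

Lemma staysS n : stays n.+1 = stays n `&` (Y n.+1 @^-1` D).
Proof.
apply/seteqP; split=> w /=.
  move=> h; split; last by apply: h; rewrite leqnn.
  by move=> i /andP[i1 ni]; apply: h; rewrite i1 leqW.
move=> [h hn] i /andP[i1]; rewrite leq_eqVlt => /orP[/eqP ->//|ni].
by apply: h; rewrite i1.
Qed.

Lemma sigma_algebraI (G : set (set Omega)) A B :
  sigma_algebra setT G -> G A -> G B -> G (A `&` B).
Proof.
move=> [G0 GC GU] GA GB; rewrite -[A `&` B]setCK setCI -!setTD.
apply: (GC); rewrite -bigcup2E; apply: GU => -[|[|n]] /=//; exact: GC.
Qed.

(** Adaptedness lets the Markov property at time n t be applied on the event
    that the first n steps stay in D. *)
Lemma stays_filtration n : F (T n) (stays n).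
Proof.
case: filtF => sF _ mF; elim: n => [|n IH].
  rewrite stays0; have [F0 FC _] := sF _ (T0 0).
  by rewrite -[setT]setD0; exact: FC.
rewrite staysS; apply: (sigma_algebraI (sF _ (T0 _))).
  by apply: (mF _ _ (T0 n)) IH; rewrite TS lerDl.
have -> : Y n.+1 @^-1` D = X (T n.+1) @^-1` [set x | D (x - x0)] by [].
apply: adX => //.
have : measurable_fun setT (fun x : R => x - x0) by exact: measurable_funB.
by move=> /(_ measurableT D mD); rewrite setTI.
Qed.

Lemma integral_start f : nnmeas f -> (\int[P]_w f (Y 0 w) = f 0%R)%E.
Proof.
move=> hf.
have mY0 : measurable_fun setT (Y 0).
  by apply: measurable_funB => //; apply: mX.
have mstart : measurable [set w | X 0 w = x0].
  by have := mX (lexx 0) measurableT (measurable_set1 x0); rewrite setTI.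
rewrite (@ge0_ae_eq_integral _ _ _ P setT _ (cst (f 0)))//.
- rewrite integral_cst// [X in (_ * X)%E](_ : _ = 1%E) ?mule1//.
  exact: probability_setT.
- by case: hf => mf _; exact: measurableT_comp.
- by move=> w _; exact: hf.2.
- by move=> w _; exact: hf.2.
exists (~` [set w | X 0 w = x0]); split.
- exact: measurableC.
- by apply: (etrans (probability_setC P mstart)); rewrite start subee.
- move=> w /=; apply: contra_not => Xw _.
  by rewrite /Y /T mul0r Xw subrr.
Qed.

(** The law of the sampled process on the event of survival is that of the
    killed walk: conditioning on the first n steps replaces the last position by
    one application of [step]. *)
Lemma integral_stays n f : nnmeas f ->
  (\int[P]_(w in stays n) f (Y n w) = surviving_walk mu D n f)%E.
Proof.
elim: n f => [|n IH] f hf; first by rewrite stays0 integral_start.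
have hfD := nnmeas_restrict mD hf.
rewrite staysS integral_mkcondr.
rewrite (eq_integral (fun w => (f \_ D) (Y n.+1 w))); last first.
  move=> w _; rewrite !patchE.
  by congr (if _ then _ else _); apply/idP/idP; rewrite !inE.
rewrite (markov_step (stays_filtration n) hfD) IH; last exact: nnmeas_step.
rewrite /surviving_walk iterSr; congr (iter n _ _ _); apply/funext => x.
by apply: eq_integral => y _; rewrite patch_setT.
Qed.

Lemma first_exit_prob n :
  P (stays n `&` (Y n.+1 @^-1` (~` D))) = exiting_walk mu D n (cst 1%E).
Proof.
have h1 : nnmeas (cst 1%E : R -> \bar R) by exact: nnmeas_cst.
have h1N := nnmeas_restrict (measurableC mD) h1.
have mA := FM (T0 n) (stays_filtration n).
rewrite -[LHS]mul1e -integral_cst//; last first.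
  apply: measurableI => //; rewrite -[X in measurable X]setTI.
  apply: (measurable_funB (mX (T0 n.+1)) (measurable_cst x0)) => //.
  exact: measurableC.
rewrite integral_mkcondr.
rewrite (eq_integral (fun w => (cst 1%E \_ (~` D)) (Y n.+1 w))); last first.
  move=> w _; rewrite !patchE.
  by congr (if _ then _ else _); apply/idP/idP; rewrite !inE.
rewrite (markov_step (stays_filtration n) h1N).
rewrite integral_stays; last exact: nnmeas_step.
congr (iter n _ _ _); apply/funext => x.
by apply: eq_integral => y _; rewrite patch_setT.
Qed.

End markov_random_walk.

Lemma marginal_prob {R : realType} d (Omega : measurableType d)
  (F : R -> set (set Omega)) (X : R -> Omega -> R)
  (P : probability Omega R) (p : R -> R.-pker R ~> R) (x0 t : R)
  (mu : probability R R) (n : nat) (B : set R) :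
  is_filtration F -> adapted F X -> P [set w | X 0 w = x0] = 1%E ->
  translation_invariant p -> is_markov P F X p -> 0 <= t ->
  (forall B, measurable B -> mu B = p t 0 B) -> measurable B ->
  P [set w | B (X (n%:R * t) w - x0)] = free_walk mu n (cst 1%E \_ B) 0.
Proof.
move=> filtF adX start pinv markovX t0 muE mB.
have h1B : nnmeas ((cst 1%E : R -> \bar R) \_ B).
  by apply: nnmeas_restrict => //; exact: nnmeas_cst.
have mX : measurable_fun setT (X (n%:R * t)).
  move=> _ C mC; rewrite setTI.
  have nt0 : 0 <= n%:R * t by rewrite mulr_ge0.
  by case: filtF => _ FM _; apply: (FM _ nt0); exact: adX.
rewrite -[LHS]mul1e -integral_cst//; last first.
  rewrite -[X in measurable X]setTI.
  exact: (measurable_funB mX (measurable_cst x0)).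
rewrite integral_mkcond.
have := integral_stays filtF adX start pinv markovX t0 muE measurableT n h1B.
rewrite (_ : stays _ _ _ _ _ = setT); last by apply/seteqP; split.
move=> E; apply: etrans E; apply: eq_integral => w _.
by rewrite !patchE; congr (if _ then _ else _); apply/idP/idP; rewrite !inE.
Qed.

(** Fubini's theorem for the walk takes the step law as a bundled probability,
    while the values of a kernel are bundled as measures only. *)
Lemma pker_probability {R : realType} (p : R.-pker R ~> R) (x : R) :
  exists mu : probability R R, forall B, mu B = p x B.
Proof.
pose f : set R -> \bar R := p x.
pose m0 := isMeasure.Build _ _ _ f (measure0 (p x)) (measure_ge0 (p x))
  (@measure_semi_sigma_additive _ _ _ (p x)).
pose mu0 : {measure set R -> \bar R} := HB.pack f m0.
pose m1 := Measure_isProbability.Build _ _ R mu0 (@prob_kernel _ _ _ _ _ p x).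
pose mu : probability R R := HB.pack f m0 m1.
by exists mu.
Qed.

(** * Expected discount at the first passage *)

Section expected_discount.
Local Set Implicit Arguments.
Local Unset Strict Implicit.
Context {R : realType} d (Omega : measurableType d).
Context (X : R -> Omega -> R) (r gamma t : R).
Hypothesis r0 : 0 < r.
Hypothesis t0 : 0 < t.

Definition first_passage n : set Omega :=
  (\bigcap_(i in [set i : nat | (1 <= i < n)%N])
    [set w | gamma <= X (i%:R * t) w]) `&` [set w | X (n%:R * t) w < gamma].

Lemma tau_first_passage n w : (0 < n)%N -> first_passage n w ->
  tau X `]-oo, gamma[%classic t w = (n%:R * t)%:E.
Proof.
move=> n0 [hlt hn]; apply/eqP; rewrite eq_le; apply/andP; split.
  by apply: ereal_inf_lbound; exists n => //=; rewrite in_itv.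
apply: le_ereal_inf_tmp => _ /= [m [m0 +] <-]; rewrite in_itv/= => hm.
rewrite lee_fin ler_pM2r// ler_nat leqNgt; apply/negP => mn.
by have := hlt m; rewrite /= m0 mn => /(_ isT); rewrite leNgt hm.
Qed.

Lemma tau_no_passage w : (forall n, (0 < n)%N -> ~ first_passage n w) ->
  tau X `]-oo, gamma[%classic t w = +oo%E.
Proof.
move=> hw; rewrite /tau (_ : [set _ | _ in _] = set0) ?ereal_inf0//.
apply/seteqP; split=> // _ /= [n [n0 +] _]; rewrite in_itv/= => hn.
have ex : exists n, (0 < n)%N && (X (n%:R * t) w < gamma).
  by exists n; rewrite n0.
case: (ex_minnP ex) => m /andP[m0 hm] mmin; apply: (hw m m0); split=> //.
move=> i /= /andP[i0 im]; rewrite leNgt; apply/negP => hi.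
by have := mmin i; rewrite i0 hi => /(_ isT); rewrite leqNgt im.
Qed.

Lemma first_passage_inj m n w : (0 < m)%N -> (0 < n)%N ->
  first_passage m w -> first_passage n w -> m = n.
Proof.
move=> m0 n0 /(tau_first_passage m0) + /(tau_first_passage n0) => -> [].
by move/(mulIf (lt0r_neq0 t0))/eqP; rewrite eqr_nat => /eqP.
Qed.

(** The events of a first passage at distinct steps are disjoint, so that at
    most one term of the series is nonzero; none is when there is no passage, in
    agreement with the discount 0 at infinity. *)
Lemma discount_first_passage w :
  (discount r (tau X `]-oo, gamma[%classic t w))%:E =
  (\sum_(n <oo) (expR (- (r * n.+1%:R * t)))%:E *
    (\1_(first_passage n.+1) w)%:E)%E.
Proof.
have [[n hn]|none] := pselect (exists n, first_passage n.+1 w).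
  rewrite (@nneseriesD1 _ _ n xpredT)//.
  rewrite eseries0 ?adde0; last first.
    move=> k _ /= kn; rewrite indicE memNset ?mule0// => hk.
    by move/negP : kn; apply; apply/eqP/succn_inj/(@first_passage_inj _ _ w).
  rewrite indicE mem_set// mule1 (@tau_first_passage n.+1)// /discount /=.
  by rewrite mulrA.
rewrite tau_no_passage; last first.
  by case=> // n _ hn; apply: none; exists n.
rewrite eseries0; last first.
  move=> k _ _; rewrite indicE memNset ?mule0// => hk.
  by apply: none; exists k.
by rewrite /discount gt0_muley ?lte_fin.
Qed.

Context (P : probability Omega R).
Hypothesis mX : forall s, 0 <= s -> measurable_fun setT (X s).

Lemma measurable_first_passage n : measurable (first_passage n).
Proof.
have mXn i : measurable_fun setT (X (i%:R * t)).
  by apply: mX; rewrite mulr_ge0// ltW.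
apply: measurableI.
  apply: fin_bigcap_measurable => [|i _].
    by apply: (@sub_finite_set _ _ `I_n) => // i /= /andP[].
  have := mXn i measurableT _ (measurable_itv `[gamma, +oo[); rewrite setTI.
  by congr measurable; apply/seteqP; split=> w /=; rewrite in_itv/= andbT.
have := mXn n measurableT _ (measurable_itv `]-oo, gamma[); rewrite setTI.
by congr measurable; apply/seteqP; split=> w /=; rewrite in_itv/=.
Qed.

Lemma measurable_discount :
  measurable_fun setT (fun w => discount r (tau X `]-oo, gamma[%classic t w)).
Proof.
apply/measurable_EFinP.
rewrite (_ : _ \o _ = fun w => (\sum_(n <oo | n \in xpredT)
    (expR (- (r * n.+1%:R * t)))%:E *
      (\1_(first_passage n.+1) w)%:E)%E); last first.
  by apply/funext => w; exact: discount_first_passage.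
apply: ge0_emeasurable_sum => k.
  by move=> w _ _; rewrite mule_ge0 ?lee_fin ?expR_ge0.
move=> _; apply: measurable_funeM; apply/measurable_EFinP.
by apply: measurable_indic; exact: measurable_first_passage.
Qed.

Lemma integral_discount :
  (\int[P]_w (discount r (tau X `]-oo, gamma[%classic t w))%:E =
  \sum_(1 <= n <oo) (expR (- (r * n%:R * t)))%:E * P (first_passage n))%E.
Proof.
under eq_integral do rewrite discount_first_passage.
rewrite integral_nneseries//; last first.
  move=> n; apply: measurable_funeM; apply/measurable_EFinP.
  by apply: measurable_indic; exact: measurable_first_passage.
rewrite -(@nneseries_addn _ _ 1); last first.
  by move=> n; rewrite mule_ge0 ?lee_fin ?expR_ge0.
apply: eq_eseriesr => n _; rewrite addn1 ge0_integralZl//=.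
- by rewrite integral_indic ?setIT//; exact: measurable_first_passage.
- apply/measurable_EFinP; apply: measurable_indic.
  exact: measurable_first_passage.
Qed.

End expected_discount.

(** * First passage of a Levy basket *)

Section levy_basket_first_passage.
Local Set Implicit Arguments.
Local Unset Strict Implicit.
Context {R : realType} d (Omega : measurableType d) (F : R -> set (set Omega)).
Context (X : R -> Omega -> R) (P : R -> probability Omega R) (r gamma : R).
Hypothesis LB : levy_basket F X P r.

Lemma levy_basket_measurable (s : R) : 0 <= s -> measurable_fun setT (X s).
Proof.
move=> s0 _ B mB; rewrite setTI.
by case: (lb_filtration LB) => _ FM _; apply: (FM _ s0); exact: (lb_adapted LB).
Qed.

Lemma first_passage_series_discount (t : R) : 0 < t ->
  first_passage_series X P r gamma t =
  (\int[P gamma]_w (discount r (tau X `]-oo, gamma[%classic t w))%:E)%E.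
Proof.
move=> t0; rewrite integral_discount//; [exact: (lb_rate LB)|].
exact: levy_basket_measurable.
Qed.

(** The first exit of the walk started at gamma is compared with marginals of
    the process started at 0: both are governed by the same step law, the
    transition probability from 0 in time t. *)
Lemma first_passage_series_spitzer (t : R) : 0 < t -> exists A : R,
  first_passage_series X P r gamma t = A%:E /\ spitzer_exp X P r t = (1 - A)%:E.
Proof.
move=> t0; have tge0 := ltW t0.
have [p [_ pinv mp]] := lb_markov LB.
have [mu muE] := pker_probability (p t) 0.
pose z := expR (- (r * t)).
have z01 : 0 <= z < 1.
  by rewrite expR_ge0 -[ltRHS]expR0 ltr_expR oppr_lt0 mulr_gt0// (lb_rate LB).
have zX n : z ^+ n = expR (- (r * n%:R * t)).
  by rewrite -expRM_natl mulrN; congr (expR (- _)); ring.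
have [A [S [hA hS AS]]] := sparre_andersen_spitzer mu z z01.
have mD : measurable (`[0, +oo[%classic : set R) by exact: measurable_itv.
exists A; split.
  rewrite -hA; apply: congr_lim; apply/funext => n.
  apply: eq_big_nat => -[|i]// _.
  rewrite zX /= -(first_exit_prob (lb_filtration LB) (lb_adapted LB)
    (lb_start LB gamma) pinv (mp gamma) tge0 (fun B _ => muE B) mD).
  congr (_ * P gamma _)%E; apply/seteqP; split=> w /= [h1 h2]; split.
  - by move=> k hk; rewrite /= in_itv/= andbT subr_ge0; exact: h1.
  - by rewrite in_itv/= andbT subr_ge0; apply/negP; rewrite -ltNge.
  - by move=> k hk; have := h1 k hk; rewrite /= in_itv/= andbT subr_ge0.
  - by move/negP: h2; rewrite in_itv/= andbT subr_ge0 -ltNge.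
rewrite /spitzer_exp AS -[(expR _)%:E]/(expeR (- S%:E)) -hS.
congr (expeR (- _)); apply: congr_lim; apply/funext => n.
apply: eq_big_nat => i _; rewrite zX.
rewrite -(@marginal_prob _ _ _ F X (P 0) p 0 t mu i _
  (lb_filtration LB) (lb_adapted LB) (lb_start LB 0) pinv (mp 0) tge0
  (fun B _ => muE B) (measurableC mD)).
congr (_ * P 0%R _)%E; apply/seteqP.
split=> w /=; rewrite in_itv/= andbT subr_ge0.
  by move=> h; apply/negP; rewrite -ltNge.
by move/negP; rewrite -ltNge.
Qed.

Lemma rho_approxE (s t : R) : 0 < s -> 0 < t ->
  rho_approx X P r `]-oo, gamma[ s gamma t =
  (first_passage_series X P r gamma t - first_passage_series X P r gamma s)%E.
Proof.
move=> s0 t0.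
have int_disc u : 0 < u -> (P gamma).-integrable setT
    (EFin \o (fun w => discount r (tau X `]-oo, gamma[%classic u w))).
  move=> u0; apply/integrableP; split.
    apply/measurable_EFinP; apply: measurable_discount => //.
      exact: (lb_rate LB).
    exact: levy_basket_measurable.
  have [A [hA _]] := first_passage_series_spitzer u0.
  rewrite (eq_integral
      (EFin \o (fun w => discount r (tau X `]-oo, gamma[%classic u w)))).
    by rewrite -first_passage_series_discount// hA ltry.
  by move=> w _; rewrite /= ger0_norm// /discount fine_ge0// expeR_ge0.
rewrite /rho_approx unlock.
under eq_integral do rewrite EFinB.
by rewrite integralB_EFin; [rewrite -!first_passage_series_discount|
  exact: measurableT|exact: int_disc|exact: int_disc].
Qed.

End levy_basket_first_passage.

Theorem theorem3p1 (R : realType) (d : measure_display)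
    (Omega : measurableType d) (F : R -> set (set Omega))
    (X : R -> Omega -> R) (P : R -> probability Omega R) (r gamma : R) :
  levy_basket F X P r ->
  forall s : R, 0 < s ->
  rho_well_defined X P r `]-oo, gamma[ s gamma ->
  [/\ cvg (first_passage_series X P r gamma t @[t --> 0^'+]),
      cvg (spitzer_exp X P r t @[t --> 0^'+]),
      rho X P r `]-oo, gamma[ s gamma =
        (lim (first_passage_series X P r gamma t @[t --> 0^'+])
         - first_passage_series X P r gamma s)%E
    & rho X P r `]-oo, gamma[ s gamma =
        (spitzer_exp X P r s - lim (spitzer_exp X P r t @[t --> 0^'+]))%E].
Proof.
move=> LB s s0; rewrite /rho_well_defined /rho => /cvg_ex[/= l hl].
have [As [hAs hSs]] := first_passage_series_spitzer gamma LB s0.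
have cA : first_passage_series X P r gamma t @[t --> 0^'+] --> (l + As%:E)%E.
  have : (rho_approx X P r `]-oo, gamma[ s gamma t + As%:E)%E @[t --> 0^'+]
      --> (l + As%:E)%E.
    by apply: cvgeD; [rewrite fin_num_adde_defl|exact: hl|exact: cvg_cst].
  apply: cvg_trans; apply: near_eq_cvg; near=> t.
  have t0 : 0 < t by near: t; exact: nbhs_right_gt.
  by rewrite (rho_approxE _ LB)// hAs subeK.
have cS : spitzer_exp X P r t @[t --> 0^'+] --> ((1 - As)%:E - l)%E.
  have : ((1 - As)%:E - rho_approx X P r `]-oo, gamma[ s gamma t)%E
      @[t --> 0^'+] --> ((1 - As)%:E - l)%E.
    by apply: cvgeB; [rewrite fin_num_adde_defr|exact: cvg_cst|exact: hl].
  apply: cvg_trans; apply: near_eq_cvg; near=> t.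
  have t0 : 0 < t by near: t; exact: nbhs_right_gt.
  have [A [hA hS]] := first_passage_series_spitzer gamma LB t0.
  by rewrite (rho_approxE _ LB)// hAs hA hS -!EFinB; congr EFin; ring.
rewrite (cvg_lim _ hl)// (cvg_lim _ cA)// (cvg_lim _ cS)// hAs hSs addeK//.
split=> //.
by case: l {hl cA cS} => [l| |]//=; rewrite -!EFinB; congr EFin; ring.
Unshelve. all: by end_near. Qed.
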